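(* Let $\Phi_\Theta$ be a modified U-net as described in the context, in the inference process after training (so that the batch-normalization statistics are fixed constants). Suppose that all the entries of the convolution matrices $K^k$ with $k\ge2$ (that is, of every convolution except the first one, $K^1$) are nonnegative, and that all the entries of all the batch-normalization scale vectors $\boldsymbol{\gamma}^k$, $k\ge1$, are nonnegative. Then $\Phi_\Theta$ is component-wise convex, i.e. each component of $\Phi_\Theta(\boldsymbol{x})$ is a convex function of the input $\boldsymbol{x}$.
   Context: Images (with several channels) are identified with column vectors by reshaping. The concatenation of two vectors is $C(\boldsymbol{u},\boldsymbol{v})=(u_1,\dots,u_m,v_1,\dots,v_n)^T$. $\operatorname{ReLU}(\boldsymbol{u})=\max\{0,\boldsymbol{u}\}$ component-wise. $\operatorname{max-pool}_{2\times2}$ partitions each channel of an image into $2\times2$ sub-matrices and returns the matrix of the maxima of the sub-matrices. A convolution is a linear operator, represented by a tensor of dimension $f_1\times f_2\times c_1\times c_2$ ($f_1\times f_2$ filter size, $c_1,c_2$ numbers of input and output channels) and written as a matrix $K^k$ acting on vectorized images. Zero padding is the embedding of an image into a larger zero image and is written as a matrix $P_0$ with entries in $\{0,1\}$. A modified U-net $\Phi_\Theta$ of depth $L$ maps an input image $\boldsymbol{x}$ to an output image as follows. Put $\boldsymbol{z}^1=\boldsymbol{x}$ and $\boldsymbol{z}^{k+1}=\sigma^k(\hat{\boldsymbol{b}}^k+W^k\hat{\boldsymbol{z}}^k)$ for $k=1,\dots,L$, where either $\hat{\boldsymbol{z}}^k=\boldsymbol{z}^k$ or (concatenation) $\hat{\boldsymbol{z}}^k=C(\boldsymbol{z}^{i_k},\boldsymbol{z}^k)$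 with $i_k\in\{1,\dots,k\}$, and $\Phi_\Theta(\boldsymbol{x})=\boldsymbol{z}^{L+1}$. The layers $1,\dots,L$ are grouped into consecutive blocks, the first of which is a right arrow, of the following types, arranged in a contracting path (right and down arrows) followed by a symmetric expanding path (up and right arrows), and ending with the last right arrow: - Right arrow (two consecutive layers $k,k+1$), realizing $\operatorname{ReLU}(\operatorname{BN}(\boldsymbol{b}^k+K^kP_0\hat{\boldsymbol{z}}^k))$: layer $k$ has $W^k=K^kP_0$, $\hat{\boldsymbol{b}}^k=\boldsymbol{b}^k$, $\sigma^k(\boldsymbol{u})=\dfrac{\boldsymbol{u}-\mathbb{E}(\mathcal{B}^k)}{\sqrt{\operatorname{Var}(\mathcal{B}^k)+\epsilon}}$ (component-wise), and layer $k+1$ has $\hat{\boldsymbol{z}}^{k+1}=\boldsymbol{z}^{k+1}$, $W^{k+1}=\operatorname{diag}(\boldsymbol{\gamma}^k)$, $\hat{\boldsymbol{b}}^{k+1}=\boldsymbol{\beta}^k$, $\sigma^{k+1}=\operatorname{ReLU}$. Here $K^k$ is a convolution with filter size $3\times3$ and stride $1$. In the expanding path, concatenation $\hat{\boldsymbol{z}}^k=C(\boldsymbol{z}^{i_k},\boldsymbol{z}^k)$ is applied before the first convolution of each level. - Down arrow (one layer $i$): $\hat{\boldsymbol{b}}^i=\boldsymbol{0}$, $W^i=I$, $\sigma^i=\operatorname{max-pool}_{2\times2}$. - Up arrow (two layers): the same form as a right arrow, with filter size $2\times2$ and a different zero padding, whose matrix $P_0$ still has entries in $\{0,1\}$. -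 Last right arrow (layer $L$): $W^L=K^LP_0$, $\hat{\boldsymbol{b}}^L=\boldsymbol{b}^L$, $\sigma^L(\boldsymbol{u})=\boldsymbol{u}$, where $K^L$ is a convolution with filter size $1\times1$ and one output channel, and all components of $\boldsymbol{b}^L$ are equal to one scalar $b_0^L\in\mathbb{R}$. The layer immediately preceding layer $L$ is a ReLU layer. The parameters $K^k,\boldsymbol{b}^k,\boldsymbol{\gamma}^k,\boldsymbol{\beta}^k$ are indexed by the layer $k$ at which the corresponding convolution occurs, so $K^1$ is the first convolution. In the inference process after training, the batch-normalization statistics $\mathbb{E}(\mathcal{B}^k)$ (mean) and $\operatorname{Var}(\mathcal{B}^k)\ge0$ (variance) are fixed constants, independent of the input, and $\epsilon>0$ is a fixed constant. *)

(* Defs.v *)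
From mathcomp Require Import all_boot all_order all_algebra.
From mathcomp Require Import all_classical all_reals.
From mathcomp Require Export convex.

Set Implicit Arguments.
Unset Strict Implicit.
Unset Printing Implicit Defensive.

Import Order.TTheory GRing.Theory Num.Theory.
Local Open Scope ring_scope.

(* Images.  An image with c channels of size h x w is the column vector that
   lists its pixels channel by channel, and row by row inside a channel.  With
   this reshaping the concatenation of the vectors of two images of the same
   size h x w is the vector of the image that stacks their channels. *)

Record img_shape := Shape { chan : nat; height : nat; width : nat }.

Definition vlen (s : img_shape) : nat := (chan s * (height s * width s))%N.

Definition img (R : realType) (s : img_shape) : Type := 'cV[R]_(vlen s).

Definition pixel_index (s : img_shape)
    (c : 'I_(chan s)) (i : 'I_(height s)) (j : 'I_(width s)) : 'I_(vlen s) :=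
  mxvec_index c (mxvec_index i j).

(* The inverse of the bijection mxvec_index. *)
Definition split_index (m n : nat) (r : 'I_(m * n)) : 'I_m * 'I_n :=
  enum_val (cast_ord (esym (mxvec_cast m n)) r).

Definition pixel (s : img_shape) (r : 'I_(vlen s)) :
    'I_(chan s) * ('I_(height s) * 'I_(width s)) :=
  ((split_index r).1, split_index (split_index r).2).

Lemma mxvec_indexK m n (i : 'I_m) (j : 'I_n) :
  split_index (mxvec_index i j) = (i, j).
Proof. by rewrite /split_index /mxvec_index cast_ordK enum_rankK. Qed.

Lemma pixel_indexK s (c : 'I_(chan s)) (i : 'I_(height s)) (j : 'I_(width s)) :
  pixel (pixel_index c i j) = (c, (i, j)).
Proof. by rewrite /pixel /pixel_index !mxvec_indexK. Qed.

Lemma vlen_stack (s t : img_shape) :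
  height s = height t -> width s = width t ->
  (vlen s + vlen t)%N = vlen (Shape (chan s + chan t) (height t) (width t)).
Proof. by rewrite /vlen /= => -> ->; rewrite mulnDl. Qed.

Definition concat (R : realType) (s t : img_shape)
    (eqh : height s = height t) (eqw : width s = width t)
    (u : img R s) (v : img R t) :
    img R (Shape (chan s + chan t) (height t) (width t)) :=
  castmx (vlen_stack eqh eqw, erefl 1%N) (col_mx u v).

(* Zero padding embeds the h x w grid of pixels into an H x W grid, in the same
   way for every channel; the new pixels are zero. *)

Record padding (h w H W : nat) := Padding {
  pad_pos :> 'I_h * 'I_w -> 'I_H * 'I_W;
  pad_inj : injective pad_pos
}.

(* The image is kept in one piece, with a border of zeros around it. *)
Definition border_padding (h w H W : nat) (p : padding h w H W) : Prop :=
  exists top left : nat, forall (i : 'I_h) (j : 'I_w),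
    (p (i, j)).1 = (top + i)%N :> nat /\ (p (i, j)).2 = (left + j)%N :> nat.

Definition pad_mx (R : realType) (c h w H W : nat) (p : padding h w H W) :
    'M[R]_(vlen (Shape c H W), vlen (Shape c h w)) :=
  \matrix_(r, q)
    let: (o, ij) := @pixel (Shape c H W) r in
    let: (c', ab) := @pixel (Shape c h w) q in
    ((o == c') && (ij == p ab))%:R.

(* The convolution of stride 1 given by a tensor T of dimension
   f1 x f2 x c1 x c2:
     (K u)_(o, i, j) = \sum_(c, p, q) T p q c o * u_(c, i + p, j + q).
   As is usual for neural networks, the filter is not flipped. *)

Definition tensor (R : realType) (f1 f2 c1 c2 : nat) : Type :=
  'I_f1 -> 'I_f2 -> 'I_c1 -> 'I_c2 -> R.

Definition conv_mx (R : realType) (f1 f2 c1 c2 h w : nat)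
    (T : tensor R f1 f2 c1 c2) :
    'M[R]_(vlen (Shape c2 h w), vlen (Shape c1 (h + f1.-1) (w + f2.-1))) :=
  \matrix_(r, q)
    let: (o, (i, j)) := @pixel (Shape c2 h w) r in
    let: (c, (a, b)) := @pixel (Shape c1 (h + f1.-1) (w + f2.-1)) q in
    \sum_(k < f1) \sum_(l < f2 | (a == i + k :> nat)%N && (b == j + l :> nat)%N)
      T k l c o.

Lemma block_index_proof (h : nat) (i : 'I_h) (a : 'I_2) : (i * 2 + a < h * 2)%N.
Proof.
have le_i1 : (i.+1 * 2 <= h * 2)%N by rewrite leq_mul2r ltn_ord orbT.
by apply: leq_trans le_i1; rewrite mulSn addnC ltn_add2r.
Qed.

Definition block_index (h : nat) (i : 'I_h) (a : 'I_2) : 'I_(h * 2) :=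
  Ordinal (block_index_proof i a).

Definition max_pool (R : realType) (c h w : nat)
    (u : img R (Shape c (h * 2) (w * 2))) : img R (Shape c h w) :=
  \col_r
    let: (o, (i, j)) := @pixel (Shape c h w) r in
    let entry (a b : 'I_2) :=
      u (@pixel_index (Shape c (h * 2) (w * 2))
           o (block_index i a) (block_index j b)) 0 in
    Num.max (Num.max (entry 0 0) (entry 0 1)) (Num.max (entry 1 0) (entry 1 1)).

Definition relu (R : realType) (n : nat) (u : 'cV[R]_n) : 'cV[R]_n :=
  \col_i Num.max 0 (u i 0).

Definition bn_normalize (R : realType) (eps : R) (n : nat) (mean var : 'cV[R]_n)
    (u : 'cV[R]_n) : 'cV[R]_n :=
  \col_i ((u i 0 - mean i 0) / Num.sqrt (var i 0 + eps)).

(* Layers, from the shape of \hat z^k to the shape of z^{k+1}. *)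

Inductive layer (R : realType) : img_shape -> img_shape -> Type :=
| RightConv (c1 c2 h w h' w' : nat) (T : tensor R 3 3 c1 c2)
    (p : padding h w (h' + 2) (w' + 2)) (_ : border_padding p)
    (bias mean var : img R (Shape c2 h' w')) (_ : forall r, 0 <= var r 0) :
    layer R (Shape c1 h w) (Shape c2 h' w')
| UpConv (c1 c2 h w h' w' : nat) (T : tensor R 2 2 c1 c2)
    (p : padding h w (h' + 1) (w' + 1))
    (bias mean var : img R (Shape c2 h' w')) (_ : forall r, 0 <= var r 0) :
    layer R (Shape c1 h w) (Shape c2 h' w')
| ScaleReLU (s : img_shape) (gamma beta : img R s) : layer R s s
| MaxPool (c h w : nat) : layer R (Shape c (h * 2) (w * 2)) (Shape c h w)
| LastConv (c h w h' w' : nat) (T : tensor R 1 1 c 1)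
    (p : padding h w (h' + 0) (w' + 0)) (_ : border_padding p) (b0 : R) :
    layer R (Shape c h w) (Shape 1 h' w').

Arguments ScaleReLU {R s} gamma beta.
Arguments MaxPool {R} c h w.

(* Each branch has the form sigma (\hat b + W \hat z). *)
Definition layer_map (R : realType) (eps : R) (s t : img_shape) (l : layer R s t) :
    img R s -> img R t :=
  match l in layer _ s t return img R s -> img R t with
  | RightConv c1 _ _ _ h' w' T p _ bias mean var _ => fun z =>
      bn_normalize eps mean var
        (bias + (conv_mx h' w' T *m pad_mx R c1 p) *m z)
  | UpConv c1 _ _ _ h' w' T p bias mean var _ => fun z =>
      bn_normalize eps mean var
        (bias + (conv_mx h' w' T *m pad_mx R c1 p) *m z)
  | ScaleReLU _ gamma beta => fun z => relu (beta + diag_mx gamma^T *m z)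
  | MaxPool _ _ _ => fun z => max_pool (0 + 1%:M *m z)
  | LastConv c _ _ h' w' T p _ b0 => fun z =>
      const_mx b0 + (conv_mx h' w' T *m pad_mx R c p) *m z
  end.

(* All the entries of the convolution matrix K of the layer, if it has one, are
   nonnegative. *)
Definition conv_nonneg (R : realType) (s t : img_shape) (l : layer R s t) : Prop :=
  match l with
  | RightConv _ _ _ _ h' w' T _ _ _ _ _ _ =>
      forall i j, 0 <= conv_mx h' w' T i j
  | UpConv _ _ _ _ h' w' T _ _ _ _ _ =>
      forall i j, 0 <= conv_mx h' w' T i j
  | LastConv _ _ _ h' w' T _ _ _ => forall i j, 0 <= conv_mx h' w' T i j
  | ScaleReLU _ _ _ | MaxPool _ _ _ => True
  end.

(* All the entries of the scale vector gamma of the layer, if it has one, are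
   nonnegative. *)
Definition scale_nonneg (R : realType) (s t : img_shape) (l : layer R s t) : Prop :=
  match l with
  | ScaleReLU _ gamma _ => forall i, 0 <= gamma i 0
  | _ => True
  end.

(* The input \hat z^k of layer k: either z^k or C(z^i, z^k) with 1 <= i <= k.
   [d j] is the shape of z^j. *)

Inductive feed (d : nat -> img_shape) (k : nat) : img_shape -> Type :=
| Plain : feed d k (d k)
| Concat (i : nat) (_ : (1 <= i <= k)%N)
    (_ : height (d i) = height (d k)) (_ : width (d i) = width (d k)) :
    feed d k (Shape (chan (d i) + chan (d k)) (height (d k)) (width (d k))).

Definition feed_val (R : realType) (d : nat -> img_shape) (k : nat) (s : img_shape)
    (f : feed d k s) (z : forall j, img R (d j)) : img R s :=
  match f in feed _ _ s return img R s with
  | Plain => z k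
  | Concat i _ eqh eqw => concat eqh eqw (z i) (z k)
  end.

Definition is_concat (d : nat -> img_shape) (k : nat) (s : img_shape)
    (f : feed d k s) : bool :=
  if f is Concat _ _ _ _ then true else false.

(* The sequence of arrows.  [Right true] is a right arrow applied to a
   concatenation.  A U-net is described by the numbers [ns] of right arrows on
   the levels of the contracting path, from the top down, each level being
   followed by a down arrow, and by the number [m] of right arrows on the bottom
   level.  The expanding path is the mirror image of the contracting path. *)

Inductive arrow := Right of bool | Down | Up | Last.

Definition contracting (ns : seq nat) (m : nat) : seq arrow :=
  flatten [seq rcons (nseq n (Right false)) Down | n <- ns]
  ++ nseq m (Right false).

Definition expanding_level (n : nat) : seq arrow :=
  Up :: (if n is n'.+1 then Right true :: nseq n' (Right false) else [::]).

Definition expanding (ns : seq nat) : seq arrow :=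
  flatten [seq expanding_level n | n <- rev ns].

Definition unet_arrows (ns : seq nat) (m : nat) : seq arrow :=
  contracting ns m ++ expanding ns ++ [:: Last].

Inductive layer_kind := KRightConv | KUpConv | KScaleReLU | KMaxPool | KLastConv.

Definition kind (R : realType) (s t : img_shape) (l : layer R s t) : layer_kind :=
  match l with
  | RightConv _ _ _ _ _ _ _ _ _ _ _ _ _ => KRightConv
  | UpConv _ _ _ _ _ _ _ _ _ _ _ _ => KUpConv
  | ScaleReLU _ _ _ => KScaleReLU
  | MaxPool _ _ _ => KMaxPool
  | LastConv _ _ _ _ _ _ _ _ _ => KLastConv
  end.

(* The layers of an arrow; the boolean tells whether the layer is applied to a
   concatenation. *)
Definition arrow_layers (a : arrow) : seq (bool * layer_kind) :=
  match a with
  | Right b => [:: (b, KRightConv); (false, KScaleReLU)]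
  | Down => [:: (false, KMaxPool)]
  | Up => [:: (false, KUpConv); (false, KScaleReLU)]
  | Last => [:: (false, KLastConv)]
  end.

Definition unet_layers (ns : seq nat) (m : nat) : seq (bool * layer_kind) :=
  flatten [seq arrow_layers a | a <- unet_arrows ns m].

(* The layers are numbered from 1 to L.  The sequences [shapes], [feed_shape],
   [feeds] and [layers] are indexed by nat for convenience; only the layers
   1, ..., L and the shapes of z^1, ..., z^{L+1} matter. *)
Record unet (R : realType) := Unet {
  levels : seq nat;
  bottom : nat;
  first_arrow_right : (0 < head bottom levels)%N;
  eps : R;
  eps_gt0 : 0 < eps;
  shapes : nat -> img_shape;
  feed_shape : nat -> img_shape;
  feeds : forall k, feed shapes k (feed_shape k);
  layers : forall k, layer R (feed_shape k) (shapes k.+1);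
  layersE :
    [seq (is_concat (feeds k), kind (layers k))
       | k <- iota 1 (size (unet_layers levels bottom))]
    = unet_layers levels bottom
}.

Definition depth (R : realType) (N : unet R) : nat :=
  size (unet_layers (levels N) (bottom N)).

Definition unet_layer (R : realType) (N : unet R) (k : nat)
    (z : forall j, img R (shapes N j)) : img R (shapes N k.+1) :=
  layer_map (eps N) (layers N k) (feed_val (feeds N k) z).

(* As layer k may use all of z^1, ..., z^k, the recursion is on a number [n] of
   rounds; z^k is reached after k rounds, see [stateE]. *)
Fixpoint states (R : realType) (N : unet R) (x : img R (shapes N 1))
    (n : nat) : forall k, img R (shapes N k) :=
  fun k =>
    match k return img R (shapes N k) with
    | 0 => 0
    | 1 => x
    | (k'.+1 as k1).+1 =>
        if n is n'.+1 then unet_layer k1 (states x n') else 0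
    end.

Definition state (R : realType) (N : unet R) (x : img R (shapes N 1))
    (k : nat) : img R (shapes N k) := states x k k.

Lemma states_stable (R : realType) (N : unet R) (x : img R (shapes N 1)) n k :
  (k <= n)%N -> states x n k = state x k.
Proof.
have stab m : forall n1 n2 j, (j <= m)%N -> (j <= n1)%N -> (j <= n2)%N ->
    states x n1 j = states x n2 j.
  elim: m => [|m IHm] n1 n2 [|[|j]] //; case: n1 => // n1; case: n2 => // n2.
  rewrite !ltnS => jm jn1 jn2 /=; rewrite /unet_layer; congr layer_map.
  case: (feeds N j.+1) => [|i /andP[_ ij] eqh eqw] /=; first exact: IHm.
  by congr concat; apply: IHm => //; apply: leq_trans ij _.
by move=> kn; apply: (stab k).
Qed.

Lemma state1 (R : realType) (N : unet R) (x : img R (shapes N 1)) :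
  state x 1 = x.
Proof. by []. Qed.

Lemma stateE (R : realType) (N : unet R) (x : img R (shapes N 1)) k :
  (1 <= k)%N -> state x k.+1 = unet_layer k (state x).
Proof.
case: k => // k _; rewrite {1}/state [LHS]/= /unet_layer; congr layer_map.
case: (feeds N k.+1) => [|i /andP[_ ik] eqh eqw] //=.
by congr concat; apply: (states_stable x ik).
Qed.

Definition Phi (R : realType) (N : unet R) (x : img R (shapes N 1)) :
    img R (shapes N (depth N).+1) :=
  state x (depth N).+1.

(* Main.v *)
(* Every layer is component-wise convex as a function of its own input, whatever
   the signs of its entries: an affine map, possibly followed by a component-wise
   maximum.  Where the convolutions and the scale vectors are nonnegative it is
   also component-wise monotone, so it maps component-wise convex functions of x
   to such functions.  The first layer need not be monotone, because its input,
   x or a concatenation of x with itself, depends linearly on x. *)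

Require Import Defs.
From mathcomp Require Import all_boot all_order all_algebra.
From mathcomp Require Import all_classical all_reals.
From mathcomp Require Import interval_inference ring.

Import Order.TTheory GRing.Theory Num.Theory.

Local Open Scope ring_scope.

Lemma maxr_convex (R : realDomainType) (t a b c d : R) : 0 <= t <= 1 ->
  Num.max (t * a + (1 - t) * b) (t * c + (1 - t) * d)
    <= t * Num.max a c + (1 - t) * Num.max b d.
Proof.
case/andP=> t_ge0 t_le1; have t'_ge0 : 0 <= 1 - t by rewrite subr_ge0.
by rewrite ge_max !lerD ?ler_wpM2l ?le_max ?lexx ?orbT.
Qed.

Lemma le_max2 d (T : orderType d) (a b c e : T) :
  (a <= c)%O -> (b <= e)%O -> (Order.max a b <= Order.max c e)%O.
Proof. by move=> ac be; rewrite ge_max !le_max ac be orbT. Qed.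

Lemma mulmx_ge0 (R : numDomainType) m n p (A : 'M[R]_(m, n)) (B : 'M[R]_(n, p)) :
  (forall i j, 0 <= A i j) -> (forall i j, 0 <= B i j) ->
  forall i j, 0 <= (A *m B) i j.
Proof. by move=> A0 B0 i j; rewrite mxE sumr_ge0 // => k _; rewrite mulr_ge0. Qed.

Lemma pad_mx_ge0 (R : realType) c h w H W (p : padding h w H W) i j :
  0 <= pad_mx R c p i j.
Proof. by rewrite mxE; case: pixel => ? ?; case: pixel => ? ?; rewrite ler0n. Qed.

Lemma affine_le (R : numDomainType) m n (A : 'M[R]_(m, n)) (b : 'cV[R]_m)
    (z w : 'cV[R]_n) :
  (forall i j, 0 <= A i j) -> (forall i, z i 0 <= w i 0) ->
  forall i, (b + A *m z) i 0 <= (b + A *m w) i 0.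
Proof.
move=> A0 zw i; rewrite !mxE lerD2l ler_sum // => k _.
by rewrite ler_wpM2l.
Qed.

Lemma convex_comb_entry (R : pzRingType) n (t : R) (u v : 'cV[R]_n) i :
  (t *: u + (1 - t) *: v) i 0 = t * u i 0 + (1 - t) * v i 0.
Proof. by rewrite !mxE. Qed.

(** The weights sum to 1, so [b] splits as [t *: b + (1 - t) *: b]. *)
Lemma affine_convex_comb (R : comPzRingType) m n (A : 'M[R]_(m, n)) (b : 'cV[R]_m)
    (t : R) (z w : 'cV[R]_n) :
  b + A *m (t *: z + (1 - t) *: w)
    = t *: (b + A *m z) + (1 - t) *: (b + A *m w).
Proof.
rewrite mulmxDr -!scalemxAr !scalerDr addrACA -scalerDl.
by rewrite (addrC t) subrK scale1r.
Qed.

(** The slope is the inverse of a square root, hence nonnegative. *)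
Lemma bn_normalize_le (R : realType) (eps : R) n (mean var z w : 'cV[R]_n) :
  (forall i, z i 0 <= w i 0) ->
  forall i, bn_normalize eps mean var z i 0 <= bn_normalize eps mean var w i 0.
Proof.
by move=> zw i; rewrite !mxE ler_wpM2r ?invr_ge0 ?sqrtr_ge0 // lerD2r.
Qed.

Lemma bn_normalize_convex_comb (R : realType) (eps : R) n
    (mean var z w : 'cV[R]_n) (t : R) :
  bn_normalize eps mean var (t *: z + (1 - t) *: w)
    = t *: bn_normalize eps mean var z + (1 - t) *: bn_normalize eps mean var w.
Proof. by apply/matrixP => i j; rewrite !mxE; ring. Qed.

Lemma relu_le (R : realType) n (z w : 'cV[R]_n) :
  (forall i, z i 0 <= w i 0) -> forall i, relu z i 0 <= relu w i 0.
Proof. by move=> zw i; rewrite !mxE le_max2. Qed.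

Lemma max_pool_le (R : realType) c h w (z1 z2 : img R (Shape c (h * 2) (w * 2))) :
  (forall i, z1 i 0 <= z2 i 0) -> forall i, max_pool z1 i 0 <= max_pool z2 i 0.
Proof.
by move=> z12 i; rewrite !mxE; case: pixel => o [a b]; rewrite !le_max2.
Qed.

Lemma layer_map_le (R : realType) (eps : R) s t (l : layer R s t) (z w : img R s) :
  conv_nonneg l -> scale_nonneg l -> (forall i, z i 0 <= w i 0) ->
  forall i, layer_map eps l z i 0 <= layer_map eps l w i 0.
Proof.
case: l z w => /=.
- move=> c1 c2 h w h' w' T p _ bias mean var _ z1 z2 K0 _ z12.
  apply: bn_normalize_le; apply: affine_le => //.
  by apply: mulmx_ge0 => // *; exact: pad_mx_ge0.
- move=> c1 c2 h w h' w' T p bias mean var _ z1 z2 K0 _ z12.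
  apply: bn_normalize_le; apply: affine_le => //.
  by apply: mulmx_ge0 => // *; exact: pad_mx_ge0.
- move=> u gamma beta z1 z2 _ g0 z12 i.
  apply: relu_le; apply: affine_le => // j k.
  (* An entry of the diagonal matrix is an entry of [gamma] taken 0 or 1 times. *)
  by rewrite !mxE mulrn_wge0.
- move=> c h w z1 z2 _ _ z12 i; rewrite !mul1mx !add0r.
  exact: max_pool_le.
- move=> c h w h' w' T p _ b0 z1 z2 K0 _ z12; apply: affine_le => //.
  by apply: mulmx_ge0 => // *; exact: pad_mx_ge0.
Qed.

Lemma relu_convex (R : realType) n (z w : 'cV[R]_n) (t : R) : 0 <= t <= 1 ->
  forall i, relu (t *: z + (1 - t) *: w) i 0
    <= t * relu z i 0 + (1 - t) * relu w i 0.
Proof.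
move=> t01 i; rewrite !mxE.
(* The constant 0 in ReLU is itself the combination of 0 and 0. *)
by have := maxr_convex _ _ 0 0 (z i 0) (w i 0) t01; rewrite !mulr0 addr0.
Qed.

Lemma max_pool_convex (R : realType) c h w
    (z1 z2 : img R (Shape c (h * 2) (w * 2))) (t : R) : 0 <= t <= 1 ->
  forall i, max_pool (t *: z1 + (1 - t) *: z2) i 0
    <= t * max_pool z1 i 0 + (1 - t) * max_pool z2 i 0.
Proof.
move=> t01 i; rewrite !mxE; case: pixel => o [p q]; rewrite /= !convex_comb_entry.
(* Convexity is used for the outer maximum and for both inner ones, which are compared under the
   outer one by its monotonicity. *)
by apply: le_trans (maxr_convex _ _ _ _ _ _ t01); rewrite le_max2 ?maxr_convex.
Qed.

Lemma layer_map_convex (R : realType) (eps : R) s t (l : layer R s t)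
    (a : R) (z w : img R s) : 0 <= a <= 1 ->
  forall i, layer_map eps l (a *: z + (1 - a) *: w) i 0
    <= a * layer_map eps l z i 0 + (1 - a) * layer_map eps l w i 0.
Proof.
move=> a01; case: l z w => /=.
- move=> c1 c2 h w h' w' T p _ bias mean var _ z1 z2 i.
  by rewrite affine_convex_comb bn_normalize_convex_comb convex_comb_entry.
- move=> c1 c2 h w h' w' T p bias mean var _ z1 z2 i.
  by rewrite affine_convex_comb bn_normalize_convex_comb convex_comb_entry.
- move=> u gamma beta z1 z2 i.
  by rewrite affine_convex_comb relu_convex.
- by move=> c h w z1 z2 i; rewrite !mul1mx !add0r max_pool_convex.
- move=> c h w h' w' T p _ b0 z1 z2 i.
  by rewrite affine_convex_comb convex_comb_entry.
Qed.

(** Concatenation only copies entries. The position [(j, r)] is chosen before [z], so one position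
    serves for the states at [x], at [y] and at their combination. *)
Lemma feed_val_entry (R : realType) (d : nat -> img_shape) k s (f : feed d k s)
    (i : 'I_(vlen s)) : (1 <= k)%N ->
  exists j (r : 'I_(vlen (d j))), (1 <= j <= k)%N /\
    forall z : forall j, img R (d j), feed_val f z i 0 = z j r 0.
Proof.
move=> k_gt0; case: f i => [|j jk eqh eqw] i /=.
  by exists k, i; rewrite k_gt0 leqnn.
case: (split_ordP (cast_ord (esym (vlen_stack eqh eqw)) i)) => r ir.
  by exists j, r; split=> // z; rewrite /concat castmxE /= ir cast_ord_id col_mxEu.
exists k, r; rewrite k_gt0 leqnn; split=> // z.
by rewrite /concat castmxE /= ir cast_ord_id col_mxEd.
Qed.

Lemma state_convex (R : realType) (N : unet R)
    (K_ge0 : forall k, (2 <= k <= depth N)%N -> conv_nonneg (layers N k))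
    (gamma_ge0 : forall k, (1 <= k <= depth N)%N -> scale_nonneg (layers N k))
    (t : R) (x y : img R (shapes N 1)) : 0 <= t <= 1 ->
  forall k, (1 <= k <= (depth N).+1)%N -> forall i,
    state (t *: x + (1 - t) *: y) k i 0
      <= t * state x k i 0 + (1 - t) * state y k i 0.
Proof.
(* Strong induction, since a concatenation may reach back to any earlier state. *)
move=> t01; elim/ltn_ind => -[//|[|k]] IH.
  by move=> _ i; rewrite !state1 !mxE.
move=> /andP[_ kL] i; rewrite !stateE // /unet_layer.
(* It remains to compare the layer at the actual input with the layer at the combination of the two
   inputs. *)
apply: le_trans (layer_map_convex _ _ _ _ _ _ _ _ t01 i).
case: k => [|k] in IH kL i *.
  set u := feed_val _ _; set v := _ + _; suff -> : u = v by [].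
  apply/matrixP => r c; rewrite ord1 !mxE {}/u {v}.
  (* For layer 1 the bounds force the source state to be 1, that is, the network input, so the two
     layer inputs coincide. *)
  have [[|[|j]] [q [// _ E]]] := feed_val_entry R _ _ _ (feeds N 1) r isT.
  by rewrite !E !state1 !mxE.
(* This is layer [k.+2], of index at least 2, so the sign hypotheses make it monotone and the inputs
   can be compared entry by entry. *)
apply: layer_map_le; [exact: K_ge0 | exact: gamma_ge0 |] => r.
have [j [q [/andP[j0 jk] E]]] := feed_val_entry R _ _ _ (feeds N k.+2) r isT.
rewrite !mxE !E; apply: IH => //.
by rewrite j0 (leq_trans jk) // ltnW.
Qed.

Theorem proposition4p1 (R : realType) (N : unet R)
    (K_ge0 : forall k, (2 <= k <= depth N)%N -> conv_nonneg (layers N k))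
    (gamma_ge0 : forall k, (1 <= k <= depth N)%N -> scale_nonneg (layers N k)) :
  forall i : 'I_(vlen (shapes N (depth N).+1)),
    convex_function [set: 'cV[R]_(vlen (shapes N 1))]%classic
      (fun x => Phi x i 0).
Proof.
(* Here [t] belongs to the unit interval type, which carries its own bounds. *)
move=> i t x y _ _; apply: state_convex => //; first by rewrite ge0 le1.
by rewrite leqnn.
Qed.
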